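(* Let $0\le q\le N$ and $m\ge 1$ be integers, and let $Y,U\in\mathbb{R}^{(N+1)\times m}$ be matrices with nonnegative entries $Y_{ij},U_{ij}$ ($i=0,\dots,N$, $j=1,\dots,m$). Assume that for every $i\in\{0,\dots,N\}$ there exists $j\in\{1,\dots,m\}$ such that $U_{0j}>0$ and $Y_{ij}>0$. Then the function $F:\mathbb{R}_+^{q+1}\to[0,\infty]$, $F(h)=\mathcal{I}(Y\|T(h)U)$, is strictly convex on its effective domain $\{h\in\mathbb{R}_+^{q+1}: F(h)<\infty\}$.
   Context: For $h=(h_0,\dots,h_q)^\top\in\mathbb{R}_+^{q+1}$ (nonnegative entries) and $N\ge q$, $T(h)\in\mathbb{R}^{(N+1)\times(N+1)}$ is the lower triangular banded Toeplitz matrix with $T(h)_{i,l}=h_{i-l}$ if $0\le i-l\le q$ and $0$ otherwise (indices $0,\dots,N$). Hence $(T(h)U)_{ij}=\sum_{k=0}^{\min(i,q)}h_kU_{i-k,j}$. For nonnegative arrays $M,N$ of the same size, indexed by $\alpha$, the I-divergence is $\mathcal{I}(M\|N)=\sum_\alpha\left(M_\alpha\log\frac{M_\alpha}{N_\alpha}-M_\alpha+N_\alpha\right)\in[0,\infty]$, with the conventions $\frac00=0$, $0\log 0=0$, $\frac p0=\infty$ for $p>0$. *)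

(* Defs.v *)
From HB Require Import structures.
From mathcomp Require Import all_boot all_order all_algebra.
From mathcomp Require Import all_classical all_reals all_analysis.

Set Implicit Arguments.
Unset Strict Implicit.
Unset Printing Implicit Defensive.

Import Order.TTheory GRing.Theory Num.Theory.

Local Open Scope classical_set_scope.
Local Open Scope ring_scope.

(* [inord] only truncates outside the band, where the entry is 0 anyway. *)
Definition toeplitz (R : realType) (q N : nat) (h : 'cV[R]_q.+1) :
    'M[R]_N.+1 :=
  \matrix_(i, l) if ((l <= i) && (i - l <= q))%N
                 then h (inord (i - l)) ord0 else 0.

(* The extended-real operations supply the usual conventions:
   0 / 0 = 0 * +oo = 0,  p / 0 = p * +oo = +oo for p > 0,
   lne 0 = -oo with 0 * -oo = 0,  and lne +oo = +oo. *)
Definition Idiv (R : realType) (m n : nat) (A B : 'M[R]_(m, n)) : \bar R :=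
  (\sum_i \sum_j ((A i j)%:E * lne ((A i j)%:E / (B i j)%:E)
                   - (A i j)%:E + (B i j)%:E))%E.

Definition nonneg_orthant (R : realType) (n : nat) : set 'cV[R]_n :=
  [set h | forall k, 0 <= h k ord0].

Definition effective_domain (R : realType) (T : Type) (C : set T)
    (f : T -> \bar R) : set T :=
  [set x | C x /\ (f x < +oo)%E].

Definition strictly_convex_on (R : realType) (E : lmodType R) (D : set E)
    (f : E -> \bar R) : Prop :=
  convex_set (D : set (convex_lmodType E)) /\
  forall (x y : E) (t : R), D x -> D y -> x <> y -> 0 < t -> t < 1 ->
    (f (t *: x + (1 - t) *: y)%R < t%:E * f x + (1 - t)%:E * f y)%E.

(* Main.v *)
Require Import Defs.
From HB Require Import structures.
From mathcomp Require Import all_boot all_order all_algebra.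
From mathcomp Require Import all_classical all_reals all_analysis.
From mathcomp Require Import ring lra.

(** The I-divergence is finite exactly when [B] is positive wherever [A] is, and
    then it is a sum of the terms [a * ln (a / b) - a + b], each convex in [b]
    and strictly so when [a > 0].  Hence it suffices to find, for [x <> y], an
    entry with [Y i j > 0] at which [T(x) U] and [T(y) U] differ.  If [k] is the
    first index with [x k <> y k], then row [k] of [T(x - y) U] is
    [(x k - y k)] times row [0] of [U], and the hypothesis applied to row [k]
    provides the column. *)

Set Implicit Arguments.
Unset Strict Implicit.
Unset Printing Implicit Defensive.

Import Order.TTheory GRing.Theory Num.Theory.

Local Open Scope classical_set_scope.
Local Open Scope ring_scope.

Lemma ln_lt_subr1 (R : realType) (x : R) : 0 < x -> x != 1 -> ln x < x - 1.
Proof.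
move=> x0 x1; rewrite ltrBrDl -[ltRHS]lnK ?posrE//.
by apply: expR_gt1Dx; rewrite ln_eq0.
Qed.

Lemma convex_comb_gt0 (R : realDomainType) (t x y : R) :
  0 < t -> t < 1 -> 0 < x -> 0 < y -> 0 < t * x + (1 - t) * y.
Proof. by move=> t0 t1 x0 y0; rewrite addr_gt0// mulr_gt0// subr_gt0. Qed.

(** With [z] the combination, [ln u < u - 1] at [u = x / z] and [u = y / z] gives two bounds whose
    right sides have weighted sum 0. *)
Lemma ln_strictly_concave (R : realType) (t x y : R) :
  0 < t -> t < 1 -> 0 < x -> 0 < y -> x != y ->
  t * ln x + (1 - t) * ln y < ln (t * x + (1 - t) * y).
Proof.
move=> t0 t1 x0 y0 xy; have z0 := convex_comb_gt0 t0 t1 x0 y0.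
set z := t * x + (1 - t) * y in z0 *.
have zN0 : z != 0 by rewrite gt_eqF.
have xz : x / z != 1.
  rewrite -subr_eq0 -[X in _ - X](divff zN0) -mulrBl mulf_neq0 ?invr_eq0//.
  have -> : x - z = (1 - t) * (x - y) by rewrite /z; ring.
  by rewrite mulf_neq0// subr_eq0// gt_eqF.
have yz : y / z != 1.
  rewrite -subr_eq0 -[X in _ - X](divff zN0) -mulrBl mulf_neq0 ?invr_eq0//.
  have -> : y - z = t * (y - x) by rewrite /z; ring.
  by rewrite mulf_neq0 ?subr_eq0 1?eq_sym// lt_eqF.
have := ln_lt_subr1 (divr_gt0 x0 z0) xz.
have := ln_lt_subr1 (divr_gt0 y0 z0) yz.
rewrite !ln_div ?posrE// => ly lx.
have e : t * (x / z - 1) + (1 - t) * (y / z - 1) = 0.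
  have -> : t * (x / z - 1) + (1 - t) * (y / z - 1) =
    (t * x + (1 - t) * y) / z - 1 by ring.
  by rewrite divff// subrr.
have : t * (ln x - ln z) + (1 - t) * (ln y - ln z) < 0.
  by rewrite -e ltrD// ltr_pM2l// subr_gt0.
lra.
Qed.

Section Idiv_term.
Context {R : realType}.
Implicit Types a b c t : R.

(** For nonnegative [a] and [b], this real version agrees with the extended summand except when
    [a > 0] and [b = 0]: there [a / 0 = 0] and [ln 0 = 0] give [- a] instead of [+oo]. *)
Definition Idiv_term a b : R := a * ln (a / b) - a + b.

Lemma Idiv_term_conv_lt t a b c : 0 < t -> t < 1 -> 0 < a -> 0 < b -> 0 < c ->
  b != c ->
  Idiv_term a (t * b + (1 - t) * c) <
    t * Idiv_term a b + (1 - t) * Idiv_term a c.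
Proof.
move=> t0 t1 a0 b0 c0 bc; rewrite /Idiv_term.
have z0 := convex_comb_gt0 t0 t1 b0 c0.
have := ln_strictly_concave t0 t1 b0 c0 bc.
rewrite -(ltr_pM2l a0) !ln_div ?posrE//.
lra.
Qed.

(** Positivity of [b] and [c] matters only for [a > 0]: at [a = 0] the term is [b] itself, which is
    linear. *)
Lemma Idiv_term_conv_le t a b c : 0 < t -> t < 1 -> 0 <= a ->
  (0 < a -> 0 < b) -> (0 < a -> 0 < c) ->
  Idiv_term a (t * b + (1 - t) * c) <=
    t * Idiv_term a b + (1 - t) * Idiv_term a c.
Proof.
move=> t0 t1; rewrite le_eqVlt => /predU1P[<- _ _|a0 /(_ a0) b0 /(_ a0) c0].
  by rewrite /Idiv_term; lra.
have [<-|bc] := eqVneq b c; last exact/ltW/Idiv_term_conv_lt.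
by rewrite -!mulrDl addrC subrK !mul1r.
Qed.

End Idiv_term.

Lemma ltr_sum_le (R : numDomainType) (I : finType) (F G : I -> R) (i0 : I) :
  (forall i, F i <= G i) -> F i0 < G i0 -> \sum_i F i < \sum_i G i.
Proof.
move=> FG FG0; rewrite (bigD1 i0)//= [ltRHS](bigD1 i0)//=.
by rewrite ltr_leD// ler_sum.
Qed.

Section Idiv.
Context {R : realType} {m n : nat}.
Implicit Types A B C : 'M[R]_(m, n).

(** For nonnegative matrices this is absolute continuity of [A] with respect to [B]. *)
Definition gt0_dominated A B := forall i j, 0 < A i j -> 0 < B i j.

Lemma gt0_dominated_conv (t : R) A B C : 0 < t -> t < 1 ->
  gt0_dominated A B -> gt0_dominated A C ->
  gt0_dominated A (t *: B + (1 - t) *: C).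
Proof.
move=> t0 t1 AB AC i j Aij; rewrite !mxE convex_comb_gt0//.
  exact: AB.
exact: AC.
Qed.

Lemma Idiv_EFin A B : (forall i j, 0 <= A i j) -> gt0_dominated A B ->
  Idiv A B = (\sum_i \sum_j Idiv_term (A i j) (B i j))%:E.
Proof.
move=> A0 AB; rewrite /Idiv -sumEFin; apply: eq_bigr => i _.
rewrite -sumEFin; apply: eq_bigr => j _; rewrite /Idiv_term.
have := A0 i j; rewrite le_eqVlt => /predU1P[<-|Aij].
  by rewrite !mul0e mul0r sub0e oppe0 add0e subr0 add0r.
have Bij := AB _ _ Aij.
by rewrite inver gt_eqF// -EFinM lne_EFin ?divr_gt0.
Qed.

Lemma Idiv_ltyP A B :
  (forall i j, 0 <= A i j) -> (forall i j, 0 <= B i j) ->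
  (Idiv A B < +oo)%E <-> gt0_dominated A B.
Proof.
move=> A0 B0; split; last by move=> AB; rewrite Idiv_EFin// ltry.
rewrite /Idiv => fin i0 j0 Aij; rewrite lt0r B0 andbT; apply/eqP => Bij.
(* Since [-oo] absorbs [+oo] in extended sums, it must be excluded from every summand before the
   infinite one at [(i0, j0)] can force the total to [+oo]. *)
have tN i j : ((A i j)%:E * lne ((A i j)%:E / (B i j)%:E)
                   - (A i j)%:E + (B i j)%:E != -oo)%E.
  have := A0 i j; rewrite le_eqVlt => /predU1P[<-|a0].
    by rewrite !mul0e.
  rewrite inver; case: (eqVneq (B i j)) => [_|bN0].
    by rewrite gt0_muley ?lte_fin// [lne +oo%E]/= gt0_muley ?lte_fin.
  have b0 : 0 < B i j by rewrite lt0r bN0 B0.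
  by rewrite -EFinM lne_EFin ?divr_gt0.
suff E : (\sum_i \sum_j ((A i j)%:E * lne ((A i j)%:E / (B i j)%:E)
                   - (A i j)%:E + (B i j)%:E))%E = +oo%E by rewrite E in fin.
apply/esum_eqyP.
  by move=> i _; apply/eqP => /esum_eqNyP[j [_ _]]; apply/eqP.
exists i0; split; rewrite ?mem_index_enum//.
apply/esum_eqyP => [j _ //|]; exists j0; split; rewrite ?mem_index_enum//.
by rewrite Bij inve0 gt0_muley ?lte_fin// [lne +oo%E]/= gt0_muley ?lte_fin.
Qed.

Lemma Idiv_conv_lt (t : R) A B C i0 j0 : 0 < t -> t < 1 ->
  (forall i j, 0 <= A i j) -> gt0_dominated A B -> gt0_dominated A C ->
  0 < A i0 j0 -> B i0 j0 != C i0 j0 ->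
  (Idiv A (t *: B + (1 - t) *: C)%R < t%:E * Idiv A B + (1 - t)%:E * Idiv A C)%E.
Proof.
move=> t0 t1 A0 AB AC Aij BC.
rewrite !Idiv_EFin//; last exact: gt0_dominated_conv.
rewrite -!EFinM -EFinD lte_fin !mulr_sumr -big_split/=.
have le i j : Idiv_term (A i j) ((t *: B + (1 - t) *: C) i j) <=
    t * Idiv_term (A i j) (B i j) + (1 - t) * Idiv_term (A i j) (C i j).
  by rewrite !mxE; apply: Idiv_term_conv_le => //; [exact: AB|exact: AC].
have lt : Idiv_term (A i0 j0) ((t *: B + (1 - t) *: C) i0 j0) <
    t * Idiv_term (A i0 j0) (B i0 j0) + (1 - t) * Idiv_term (A i0 j0) (C i0 j0).
  by rewrite !mxE; apply: Idiv_term_conv_lt => //; [exact: AB|exact: AC].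
(* Strictness passes from the entry to its row sum, then from row [i0] to the total. *)
apply: (@ltr_sum_le _ _ _ _ i0) => [i|]; rewrite !mulr_sumr -big_split/=.
  by apply: ler_sum => j _; exact: le.
by apply: (@ltr_sum_le _ _ _ _ j0) => // j; exact: le.
Qed.

End Idiv.

Section toeplitz.
Context {R : realType} {q N : nat}.
Implicit Types h x y : 'cV[R]_q.+1.

Lemma toeplitzD x y : toeplitz N (x + y) = toeplitz N x + toeplitz N y.
Proof. by apply/matrixP => i l; rewrite !mxE; case: ifP; rewrite ?mxE ?addr0. Qed.

Lemma toeplitzZ (a : R) x : toeplitz N (a *: x) = a *: toeplitz N x.
Proof. by apply/matrixP => i l; rewrite !mxE; case: ifP; rewrite ?mxE ?mulr0. Qed.

Lemma toeplitzN x : toeplitz N (- x) = - toeplitz N x.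
Proof. by rewrite -scaleN1r toeplitzZ scaleN1r. Qed.

Lemma toeplitz_mul_ge0 m h (U : 'M[R]_(N.+1, m)) :
  nonneg_orthant h -> (forall i j, 0 <= U i j) ->
  forall i j, 0 <= (toeplitz N h *m U) i j.
Proof.
move=> h0 U0 i j; rewrite mxE sumr_ge0// => l _; rewrite mulr_ge0// mxE.
by case: ifP.
Qed.

(** In row [k], the factor of [U l j] is [h] at index [k - l]. For [l > 0] this index lies below
    [k], where [h] vanishes, so only [l = 0] survives. *)
Lemma toeplitz_mul_lead_row m h (U : 'M[R]_(N.+1, m)) (k : 'I_q.+1)
    (i : 'I_N.+1) (j : 'I_m) : i = k :> nat ->
  (forall l : 'I_q.+1, (l < k)%N -> h l ord0 = 0) ->
  (toeplitz N h *m U) i j = h k ord0 * U ord0 j.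
Proof.
move=> ik hk; rewrite mxE (bigD1 ord0)//= big1 ?addr0 => [|l l0].
  by rewrite mxE subn0 ik leq0n -ltnS (ltn_ord k) inord_val.
rewrite mxE; case: ifP => [/andP[li ilq]|_]; last by rewrite mul0r.
rewrite hk ?mul0r// inordK// -ik ltn_subLR// addnC -[ltnLHS]addn0 ltn_add2l.
by rewrite lt0n -val_eqE in l0 *.
Qed.

Lemma first_diff_index n (x y : 'cV[R]_n) : x <> y ->
  exists2 k, x k ord0 != y k ord0 &
    forall l : 'I_n, (l < k)%N -> x l ord0 = y l ord0.
Proof.
move=> xy; have [k0 xyk0] : exists k, x k ord0 != y k ord0.
  apply: contrapT => /forallNP xyE; apply: xy.
  by apply/colP => k; apply/eqP/negPn/negP; exact: xyE.
case: (arg_minnP (P := fun k => x k ord0 != y k ord0) (@nat_of_ord n) xyk0).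
move=> k xyk kmin; exists k => // l lk; apply/eqP/negPn/negP => /kmin.
by rewrite leqNgt lk.
Qed.

(** The row is fixed before the column, since the column supplied by the positivity assumption on
    [Y] and [U] depends on the row. *)
Lemma toeplitz_mul_diff m x y (U : 'M[R]_(N.+1, m)) : (q <= N)%N -> x <> y ->
  exists i : 'I_N.+1, forall j, U ord0 j != 0 ->
    (toeplitz N x *m U) i j != (toeplitz N y *m U) i j.
Proof.
move=> qN /first_diff_index[k xyk xyl].
(* The first differing index [k] is a valid row because [k <= q <= N]. *)
pose i : 'I_N.+1 := widen_ord (qN : q < N.+1)%N k.
exists i => j Uj; rewrite -subr_eq0.
have -> : (toeplitz N x *m U) i j - (toeplitz N y *m U) i j =
    (toeplitz N (x - y) *m U) i j.
  by rewrite toeplitzD toeplitzN mulmxBl [RHS]mxE [X in _ = _ + X]mxE.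
rewrite (@toeplitz_mul_lead_row _ _ _ k)// => [|l lk].
  by rewrite !mxE mulf_neq0// subr_eq0.
by rewrite !mxE xyl// subrr.
Qed.

End toeplitz.

Theorem lemma2p3 (R : realType) (q N m : nat) (hqN : (q <= N)%N)
    (hm : (1 <= m)%N) (Y U : 'M[R]_(N.+1, m))
    (Y_ge0 : forall i j, 0 <= Y i j) (U_ge0 : forall i j, 0 <= U i j)
    (hYU : forall i : 'I_N.+1, exists j : 'I_m, 0 < U ord0 j /\ 0 < Y i j) :
  let F := fun h : 'cV[R]_q.+1 => Idiv Y (toeplitz N h *m U) in
  strictly_convex_on (effective_domain (@nonneg_orthant R q.+1) F) F.
Proof.
move=> F.
have TE (t : R) (x y : 'cV[R]_q.+1) : toeplitz N (t *: x + (1 - t) *: y) *m U =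
    t *: (toeplitz N x *m U) + (1 - t) *: (toeplitz N y *m U).
  by rewrite toeplitzD !toeplitzZ mulmxDl !scalemxAl.
have domP x : effective_domain (@nonneg_orthant R q.+1) F x <->
    nonneg_orthant x /\ gt0_dominated Y (toeplitz N x *m U).
  by split=> -[x0 Fx]; split=> //; apply/Idiv_ltyP => //; exact: toeplitz_mul_ge0.
split.
  (* Only weights strictly between 0 and 1 need checking; these preserve both conditions of
     [domP]. *)
  apply/convex_setW => x y /set_mem/domP[x0 Dx] /set_mem/domP[y0 Dy] t t0 t1.
  apply/mem_set/domP; split.
    by move=> k; rewrite !mxE addr_ge0// mulr_ge0// ltW// subr_gt0.
  by rewrite TE; exact: gt0_dominated_conv.
move=> x y t /domP[x0 Dx] /domP[y0 Dy] xy t0 t1.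
have [i xyi] := toeplitz_mul_diff U hqN xy.
(* In this column [U ord0 j > 0] separates the two products and [Y i j > 0] makes the term strictly
   convex. *)
have [j [Uj Yij]] := hYU i.
by rewrite /F TE; apply: Idiv_conv_lt Yij (xyi _ _) => //; rewrite gt_eqF.
Qed.
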